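(* Assume the noise is mean-preserving, i.e. $\mathbb E^{\mathbb O(\cdot\mid x)}[X^\star\mid X=x]=x$ for all $x\in\mathfrak X$. For every $\varepsilon>0$, the optimal values $g^*_{\rm noise}(\varepsilon)$ of the noisy-data DRO problem and $g^*(\varepsilon)$ of the direct DRO problem satisfy $$g^*_{\rm noise}(\varepsilon)\ \ge\ g^*(\varepsilon).$$
   Context: Setting. $\mathfrak X=\{x\in\mathbb R^n: x_{\min}\le x\le x_{\max}\}$ (componentwise) is a compact box, and $\mathfrak X^\star\subseteq\mathbb R^n$ is a compact convex set with $\mathfrak X\subseteq\mathfrak X^\star$. The noise is additive: the noisy observation of a latent vector $X$ is $X^\star=X+E$ with $E$ independent of $X$, $E\sim\mathbb F_E$, $\mathbb E\|E\|<\infty$; the known noise kernel is $\mathbb O(A\mid x)=\mathbb P(X^\star\in A\mid X=x)=\mathbb F_E(A-x)$, where $A-x=\{z:z+x\in A\}$, and for each $x\in\mathfrak X$ it is supported on $\mathfrak X^\star$. $\widehat x^\star_1,\dots,\widehat x^\star_N\in\mathfrak X^\star$ are the observed noisy samples. $\|\cdot\|$ is the $\ell_1$-norm. $\mathcal W\subseteq\mathbb R^n$ is a compact set of decisions and $U:\mathbb R\to\mathbb R$ is continuous, concave and nondecreasing. Noisy-data DRO problem. $g^*_{\rm noise}(\varepsilon)$ is the optimal value of $$\sup_{w\in\mathcal W,\ \lambda\ge0,\ a_1,\dots,a_N\in\mathbb R}\ -\lambda\varepsilon+\frac1N\sum_{j=1}^N a_j\quad\text{s.t.}\quad \inf_{x\in\mathfrak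 X}\left(U(\langle w,x\rangle)+\lambda\int_{\mathfrak X^\star}\|x^\star-\widehat x^\star_j\|\,d\mathbb O(x^\star\mid x)\right)\ge a_j,\ \ j=1,\dots,N.$$ Direct DRO problem (the observed noisy samples are treated as if noise-free). $g^*(\varepsilon)$ is the optimal value of $$\sup_{w\in\mathcal W,\ \lambda\ge0,\ a_1,\dots,a_N\in\mathbb R}\ -\lambda\varepsilon+\frac1N\sum_{j=1}^N a_j\quad\text{s.t.}\quad \inf_{x\in\mathfrak X}\left(U(\langle w,x\rangle)+\lambda\|x-\widehat x^\star_j\|\right)\ge a_j,\ \ j=1,\dots,N.$$ *)

(* Defs.v *)
From HB Require Import structures.
From mathcomp Require Import all_boot all_order all_algebra.
From mathcomp Require Import all_classical all_reals all_analysis.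

Set Implicit Arguments.
Unset Strict Implicit.
Unset Printing Implicit Defensive.

Import Order.TTheory GRing.Theory Num.Theory.
Import numFieldNormedType.Exports.

Local Open Scope classical_set_scope.
Local Open Scope ring_scope.

(* ['rV[R]_n] carries no sigma-algebra in the library; this alias of it carries
   the Borel one. *)
Definition borelRV (R : realType) (n : nat) :=
  g_sigma_algebraType (@open 'rV[R]_n).

(* The norm [`|x|] that the library puts on ['rV[R]_n] is the max norm. *)
Definition l1norm (R : realType) (n : nat) (x : 'rV[R]_n) : R :=
  \sum_(i < n) `|x 0 i|.

Definition dotv (R : realType) (n : nat) (w x : 'rV[R]_n) : R :=
  \sum_(i < n) w 0 i * x 0 i.

Definition box (R : realType) (n : nat) (xmin xmax : 'rV[R]_n) :
    set 'rV[R]_n :=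
  [set x | forall i, xmin 0 i <= x 0 i <= xmax 0 i].

Definition concave_fun (R : realType) (U : R -> R) : Prop :=
  @convex_function R R^o setT (fun t => - U t).

Definition independent_RV d d1 d2 (Omega : measurableType d)
    (T1 : measurableType d1) (T2 : measurableType d2) (R : realType)
    (P : probability Omega R) (X : {RV P >-> T1}) (Y : {RV P >-> T2}) : Prop :=
  forall (A : set T1) (B : set T2), measurable A -> measurable B ->
    P (X @^-1` A `&` Y @^-1` B) = (P (X @^-1` A) * P (Y @^-1` B))%E.

(* [[set z | A (z + x)]] is the translate [A - x]. *)
Definition noise_kernel (R : realType) (n : nat)
    (FE : set (borelRV R n) -> \bar R) (x : 'rV[R]_n) :
    set (borelRV R n) -> \bar R :=
  fun A => FE [set z : 'rV[R]_n | A (z + x)].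

Lemma measurable_translation (R : realType) (n : nat) (x : 'rV[R]_n) :
  measurable_fun [set: borelRV R n]
    ((fun z : 'rV[R]_n => z + x) : borelRV R n -> borelRV R n).
Proof.
apply: (@measurability _ _ (borelRV R n) (borelRV R n) _ _ (@open 'rV[R]_n)) => //.
move=> _ [B oB <-]; rewrite setTI; apply: sub_sigma_algebra.
have cf : continuous (fun z : 'rV[R]_n => z + x).
  by move=> z; apply: (@continuousD _ _ _ idfun) => //; exact: cst_continuous.
by move/continuousP : cf; apply.
Qed.

Section noise_kernel_probability.
Context (R : realType) (n : nat) (FE : probability (borelRV R n) R).
Variable x : 'rV[R]_n.

Let shift : borelRV R n -> borelRV R n := fun z : 'rV[R]_n => z + x.

HB.instance Definition _ := isMeasurableFun.Build _ _ _ _ shift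
  (@measurable_translation R n x).

Let kernel0 : noise_kernel FE x set0 = 0%E.
Proof. exact: (measure0 (distribution FE shift)). Qed.

Let kernel_ge0 A : (0 <= noise_kernel FE x A)%E.
Proof. exact: (measure_ge0 (distribution FE shift)). Qed.

Let kernel_sigma_additive : semi_sigma_additive (noise_kernel FE x).
Proof. exact: (@measure_semi_sigma_additive _ _ _ (distribution FE shift)). Qed.

HB.instance Definition _ := isMeasure.Build _ _ _ (noise_kernel FE x)
  kernel0 kernel_ge0 kernel_sigma_additive.

Let kernel_setT : noise_kernel FE x [set: _] = 1%:E.
Proof. exact: (probability_setT (distribution FE shift)). Qed.

HB.instance Definition _ := Measure_isProbability.Build _ _ _
  (noise_kernel FE x) kernel_setT.

End noise_kernel_probability.

Definition supported_on (R : realType) (n : nat)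
    (mu : set (borelRV R n) -> \bar R) (S : set 'rV[R]_n) : Prop :=
  mu (~` S) = 0%E.

(* The vector-valued mean is read coordinatewise. *)
Definition has_mean (R : realType) (n : nat)
    (mu : set (borelRV R n) -> \bar R) (m : 'rV[R]_n) : Prop :=
  forall i : 'I_n,
    (\int[mu]_(y in [set: borelRV R n]) ((y : 'rV[R]_n) 0 i)%:E)%E = (m 0 i)%:E.

Definition mean_preserving (R : realType) (n : nat) (X : set 'rV[R]_n)
    (K : 'rV[R]_n -> set (borelRV R n) -> \bar R) : Prop :=
  forall x, X x -> has_mean (K x) x.

(* Common form of the noisy-data and the direct problems, which differ only in
   the transport cost [cost j x] from [x] to the [j]-th sample. The infimum is
   taken in the extended reals. *)
Definition dro_feasible (R : realType) (n N : nat) (X W : set 'rV[R]_n)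
    (U : R -> R) (cost : 'I_N -> 'rV[R]_n -> \bar R)
    (w : 'rV[R]_n) (lambda : R) (a : 'I_N -> R) : Prop :=
  [/\ W w, 0 <= lambda &
      forall j, ((a j)%:E <=
        ereal_inf [set (U (dotv w x))%:E + lambda%:E * cost j x | x in X])%E].

Definition dro_value (R : realType) (n N : nat) (X W : set 'rV[R]_n)
    (U : R -> R) (cost : 'I_N -> 'rV[R]_n -> \bar R) (eps : R) : \bar R :=
  ereal_sup [set v | exists w lambda a,
    dro_feasible X W U cost w lambda a /\
    v = (- lambda * eps + N%:R^-1 * \sum_(j < N) a j)%:E].

Definition noise_cost (R : realType) (n N : nat) (Xs : set 'rV[R]_n)
    (K : 'rV[R]_n -> set (borelRV R n) -> \bar R) (xhat : 'I_N -> 'rV[R]_n)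
    (j : 'I_N) (x : 'rV[R]_n) : \bar R :=
  (\int[K x]_(y in Xs)
     (l1norm ((y : 'rV[R]_n) - xhat j))%:E)%E.

Definition direct_cost (R : realType) (n N : nat) (xhat : 'I_N -> 'rV[R]_n)
    (j : 'I_N) (x : 'rV[R]_n) : \bar R :=
  (l1norm (x - xhat j))%:E.

Definition g_noise (R : realType) (n N : nat) (X Xs W : set 'rV[R]_n)
    (U : R -> R) (K : 'rV[R]_n -> set (borelRV R n) -> \bar R)
    (xhat : 'I_N -> 'rV[R]_n) (eps : R) : \bar R :=
  dro_value X W U (noise_cost Xs K xhat) eps.

Definition g_direct (R : realType) (n N : nat) (X W : set 'rV[R]_n)
    (U : R -> R) (xhat : 'I_N -> 'rV[R]_n) (eps : R) : \bar R :=
  dro_value X W U (direct_cost xhat) eps.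

(* Main.v *)
(* Mean preservation and Jensen's inequality for the l1-norm show that the noisy
   transport cost dominates the direct one at every point of the box. Hence each
   point feasible for the direct problem is feasible, with the same objective,
   for the noisy one. *)

Require Import Defs.
From HB Require Import structures.
From mathcomp Require Import all_boot all_order all_algebra.
From mathcomp Require Import all_classical all_reals all_analysis.
From mathcomp Require Import measurable_realfun.

Import Order.TTheory GRing.Theory Num.Theory.
Import numFieldNormedType.Exports.

Local Open Scope classical_set_scope.
Local Open Scope ring_scope.

(* As [+oo - +oo = -oo], a finite value of the integral forces both the positive
   and the negative parts to have finite integrals. *)
Lemma fin_num_integral_integrable d (T : measurableType d) (R : realType)
  (mu : {measure set T -> \bar R}) (D : set T) (f : T -> \bar R) :
  measurable D -> measurable_fun D f ->
  (\int[mu]_(x in D) f x)%E \is a fin_num -> mu.-integrable D f.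
Proof.
move=> mD mf; rewrite integralE fin_numB => /andP[fp fn].
apply/integrableP; split=> //.
(* The absolute value of [f] is the sum of its positive and negative parts, so its integral is a sum
   of two finite terms. *)
under eq_integral do rewrite -/((abse \o f) _) fune_abse.
rewrite ge0_integralD//.
- by rewrite ltey_eq fin_numD fp fn.
- exact: measurable_funepos.
- exact: measurable_funeneg.
Qed.

(** Jensen's inequality for the convex function [|t - c|]: the absolute value of an integral is at
    most the integral of the absolute value. Integrability of [f] comes from its mean being a real
    number. *)
Lemma dist_mean_le d (T : measurableType d) (R : realType)
  (P : probability T R) (f : T -> R) (m c : R) :
  measurable_fun setT f -> (\int[P]_x (f x)%:E = m%:E)%E ->
  (`|m - c|%:E <= \int[P]_x `|f x - c|%:E)%E.
Proof.
move=> mf fm.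
have mEf : measurable_fun setT (EFin \o f) by exact/measurable_EFinP.
have intf : P.-integrable setT (EFin \o f).
  by apply: fin_num_integral_integrable => //=; rewrite fm.
have intc : P.-integrable setT (EFin \o cst c).
  exact: finite_measure_integrable_cst.
change (`|(m - c)%:E| <= \int[P]_x `|(f x - c)%:E|)%E.
have <- : (\int[P]_x (f x - c)%:E = (m - c)%:E)%E.
  under eq_integral do rewrite EFinB.
  rewrite (integralB_EFin measurableT intf intc) fm.
  (* Total mass 1 is what makes the integral of the constant equal to [c]. *)
  have -> : (\int[P]_x (cst c x)%:E = c%:E)%E.
    rewrite [LHS](integral_cst P measurableT c%:E).
    by rewrite [X in (_ * X)%E](probability_setT P) mule1.
  by rewrite EFinB.
apply: (le_abse_integral P measurableT).
by apply/measurable_EFinP; exact: measurable_funB.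
Qed.

Section borelRV_theory.
Context (R : realType) (n : nat).

Lemma open_measurable_borelRV (A : set 'rV[R]_n) :
  open A -> measurable (A : set (borelRV R n)).
Proof. exact: sub_sigma_algebra. Qed.

Lemma compact_measurable_borelRV (A : set 'rV[R]_n) :
  compact A -> measurable (A : set (borelRV R n)).
Proof.
move=> cA; rewrite -(setCK (A : set (borelRV R n))).
apply: measurableC; apply: open_measurable_borelRV; apply: closed_openC.
by apply: compact_closed => //; exact: norm_hausdorff.
Qed.

Lemma continuous_measurable_borelRV (f : 'rV[R]_n -> R) :
  continuous f -> measurable_fun [set: borelRV R n] (f : borelRV R n -> R).
Proof.
move=> /continuousP cf.
(* Only preimages of the generating open intervals need checking, and these are open by
   continuity. *)
apply: (measurability _ (RGenOpens.measurableE R)) => _ [_ [a [b ->]] <-].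
rewrite setTI; apply: open_measurable_borelRV; apply: cf; exact: interval_open.
Qed.

End borelRV_theory.

(** The cost enters only the constraints, with a nonnegative multiplier; raising it relaxes them and
    leaves the objective unchanged. *)
Lemma dro_value_le (R : realType) (n N : nat) (X W : set 'rV[R]_n)
  (U : R -> R) (c1 c2 : 'I_N -> 'rV[R]_n -> \bar R) (eps : R) :
  (forall j x, X x -> (c1 j x <= c2 j x)%E) ->
  (dro_value X W U c1 eps <= dro_value X W U c2 eps)%E.
Proof.
move=> c12; apply: ereal_sup_le => _ [w [l [a [[Ww l0 al] ->]]]].
exists w, l, a; split=> //; split=> // j.
apply: (le_trans (al j)); apply/ereal_infP => _ [x Xx <-].
apply: (@le_trans _ _ ((U (dotv w x))%:E + l%:E * c1 j x)%E).
  by apply: ereal_inf_lbound; exists x.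
by apply: leeD2l; apply: lee_wpmul2l; [rewrite lee_fin|exact: c12].
Qed.

(** The l1-norm is a sum over coordinates, so the scalar inequality applies to each coordinate and
    the results add up. *)
Lemma l1dist_mean_le (R : realType) (n : nat)
  (mu : probability (borelRV R n) R) (S : set 'rV[R]_n) (m c : 'rV[R]_n) :
  measurable (S : set (borelRV R n)) -> supported_on mu S -> has_mean mu m ->
  ((l1norm (m - c))%:E <=
   \int[mu]_(y in S) (l1norm ((y : 'rV[R]_n) - c))%:E)%E.
Proof.
move=> mS muS mum.
have mcoord i : measurable_fun [set: borelRV R n] (fun y : 'rV[R]_n => y 0 i).
  by apply: continuous_measurable_borelRV; exact: coord_continuous.
have mdist i : measurable_fun [set: borelRV R n]
    (fun y : 'rV[R]_n => `|y 0 i - c 0 i|%:E).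
  apply/measurable_EFinP; apply: measurableT_comp => //.
  exact: measurable_funB.
have l1E (y : 'rV[R]_n) :
    ((l1norm (y - c))%:E = \sum_(i < n) `|y 0 i - c 0 i|%:E)%E.
  by rewrite sumEFin; congr EFin; apply: eq_bigr => i _; rewrite !mxE.
rewrite (_ : S = [set: borelRV R n] `\` ~` S); last by rewrite setTD setCK.
rewrite -(ge0_negligible_integral (measurableC mS) measurableT _ _ muS).
- rewrite l1E; under eq_integral do rewrite l1E.
  rewrite ge0_integral_sum//; apply: lee_sum => i _.
  exact: dist_mean_le.
- under eq_fun do rewrite l1E.
  exact: emeasurable_sum.
- by move=> y _; rewrite l1E; apply: sume_ge0.
Qed.

Theorem theorem4p2 (R : realType) (n N : nat) (hN : (0 < N)%N)
  (xmin xmax : 'rV[R]_n) (Xs W : set 'rV[R]_n)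
  (hXs_compact : compact Xs) (hXs_convex : convex_set Xs)
  (hX_Xs : box xmin xmax `<=` Xs)
  (d : measure_display) (Omega : measurableType d) (P : probability Omega R)
  (X E : {RV P >-> borelRV R n})
  (hXE : independent_RV X E)
  (hE : ('E_P[fun omega => l1norm (E omega)] < +oo)%E)
  (hsupp : forall x, box xmin xmax x ->
     supported_on (noise_kernel (distribution P E) x) Xs)
  (xhat : 'I_N -> 'rV[R]_n) (hxhat : forall j, Xs (xhat j))
  (hW : compact W)
  (U : R -> R) (hU_cont : continuous U) (hU_concave : concave_fun U)
  (hU_nondecr : {homo U : s t / s <= t})
  (hmean : mean_preserving (box xmin xmax) (noise_kernel (distribution P E)))
  (eps : R) (heps : 0 < eps) :
  (g_noise (box xmin xmax) Xs W U (noise_kernel (distribution P E)) xhat eps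
   >= g_direct (box xmin xmax) W U xhat eps)%E.
Proof.
apply: dro_value_le => j x Xx.
apply: l1dist_mean_le; [|exact: hsupp|exact: hmean].
(* What remains is the measurability of [Xs], which follows from its compactness. *)
exact: compact_measurable_borelRV.
Qed.
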